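(* Let $\mathcal X,\mathcal Y_1,\mathcal Y_2,\mathcal W$ be finite nonempty sets and $g:\mathcal W\times\mathcal X\to[0,1]$ a gain function. For any prior $\pi$ on $\mathcal X$ with $V_g(\pi)>0$ and any two channels $(\mathcal X,\mathcal Y_1,C_1)$ and $(\mathcal X,\mathcal Y_2,C_2)$, $$I_g(\pi,C_1\parallel C_2)\ \le\ I_g(\pi,C_1)+I_g(\pi,C_2)+H_g^{\min}(\pi)-H_g(\pi).$$
   Context: A (discrete) channel $(\mathcal X,\mathcal Y,C)$ consists of finite sets $\mathcal X,\mathcal Y$ and a matrix $C$ with entries $C[x,y]\ge 0$ and $\sum_{y}C[x,y]=1$ for each $x$. A prior on $\mathcal X$ is a probability distribution on $\mathcal X$. The parallel composition with shared input $C_1\parallel C_2$ is the channel from $\mathcal X$ to $\mathcal Y_1\times\mathcal Y_2$ with $(C_1\parallel C_2)[x,(y_1,y_2)]=C_1[x,y_1]\,C_2[x,y_2]$. $V_g(\pi)=\max_{w\in\mathcal W}\sum_{x}\pi[x]g(w,x)$, $V_g(\pi,C)=\sum_{y}\max_{w\in\mathcal W}\sum_x\pi[x]C[x,y]g(w,x)$, $H_g(\pi)=-\log V_g(\pi)$, $H_g(\pi,C)=-\log V_g(\pi,C)$, and the $g$-leakage is $I_g(\pi,C)=H_g(\pi)-H_g(\pi,C)$. Logarithms are to base 2. $H_g^{\min}(\pi)=-\log\min\{\pi[x]g(w,x): x\in\mathcal X,\ w\in\mathcal W,\ \pi[x]g(w,x)\ne0\}$. *)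

(* Defs.v *)
From HB Require Import structures.
From mathcomp Require Import all_boot all_order all_algebra.
From mathcomp Require Import reals exp.

Set Implicit Arguments.
Unset Strict Implicit.
Unset Printing Implicit Defensive.

Import Order.TTheory GRing.Theory Num.Theory.
Local Open Scope ring_scope.

Record prior (R : realType) (X : finType) := Prior {
  prior_fun :> X -> R;
  prior_ge0 : forall x, 0 <= prior_fun x;
  prior_sum1 : \sum_(x : X) prior_fun x = 1 }.

Record channel (R : realType) (X Y : finType) := Channel {
  channel_fun :> X -> Y -> R;
  channel_ge0 : forall x y, 0 <= channel_fun x y;
  channel_sum1 : forall x, \sum_(y : Y) channel_fun x y = 1 }.

Section Parallel.
Variables (R : realType) (X Y1 Y2 : finType).
Variables (C1 : channel R X Y1) (C2 : channel R X Y2).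

Definition par_fun (x : X) (y : Y1 * Y2) : R := C1 x y.1 * C2 x y.2.

Lemma par_ge0 x y : 0 <= par_fun x y.
Proof. by apply: mulr_ge0; apply: channel_ge0. Qed.

Lemma par_sum1 x : \sum_(y : Y1 * Y2) par_fun x y = 1.
Proof.
rewrite -(pair_bigA _ (fun y1 y2 => C1 x y1 * C2 x y2)) /=.
under eq_bigr => y1 _ do rewrite -mulr_sumr channel_sum1 mulr1.
exact: channel_sum1.
Qed.

Definition par_channel : channel R X (Y1 * Y2)%type :=
  Channel par_ge0 par_sum1.

End Parallel.

Section Leakage.
Variable R : realType.

(* Starting the iteration from the head makes these the genuine maximum and
   minimum of any nonempty list, whatever the signs of its entries; both are 0
   on the empty list. *)
Definition seq_max (s : seq R) : R := \big[Num.max/head 0 s]_(a <- s) a.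
Definition seq_min (s : seq R) : R := \big[Num.min/head 0 s]_(a <- s) a.

(* [ln] is 0 on nonpositive reals, so [log2] is meaningful only on positive
   ones. When g >= 0 and Vg g pi > 0, every [log2] below has a positive
   argument, since Vg g pi <= Vg_chan g pi C. *)
Definition log2 (x : R) : R := ln x / ln 2.

Variables X W : finType.
Implicit Types (g : W -> X -> R) (pi : prior R X).

Definition Vg g pi : R :=
  seq_max [seq \sum_(x : X) pi x * g w x | w <- enum W].

Definition Vg_chan g pi (Y : finType) (C : channel R X Y) : R :=
  \sum_(y : Y) seq_max [seq \sum_(x : X) pi x * C x y * g w x | w <- enum W].

Definition Hg g pi : R := - log2 (Vg g pi).

Definition Hg_chan g pi (Y : finType) (C : channel R X Y) : R :=
  - log2 (Vg_chan g pi C).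

Definition Ig g pi (Y : finType) (C : channel R X Y) : R :=
  Hg g pi - Hg_chan g pi C.

Definition Hg_min g pi : R :=
  - log2 (seq_min
      [seq a <- [seq pi x * g w x | x <- enum X, w <- enum W] | a != 0]).

End Leakage.

(* Main.v *)
Require Import Defs.
From mathcomp Require Import all_boot all_order all_algebra.
From mathcomp Require Import reals exp.
From mathcomp Require Import lra.
Import Order.TTheory GRing.Theory Num.Theory.
Local Open Scope ring_scope.

Set Implicit Arguments.
Unset Strict Implicit.
Unset Printing Implicit Defensive.

(* Taking logarithms, the claim reads V(C1 || C2) * m <= V(C1) * V(C2), where m
   is the least nonzero value of pi x * g w x.  For fixed w, y1 and y2, write
   u x for pi x * g w x: since u x * m <= u x ^ 2,
     \sum_x u x * C1 x y1 * C2 x y2 * m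
       <= \sum_x (u x * C1 x y1) * (u x * C2 x y2)
       <= (\sum_x u x * C1 x y1) * (\sum_x u x * C2 x y2). *)

Section SeqExtrema.
Variable R : realType.
Implicit Types (s : seq R) (a : R).

Lemma le_seq_max s a : a \in s -> a <= seq_max s.
Proof. by move=> sa; exact: (le_bigmax_seq _ a xpredT id). Qed.

Lemma seq_min_le s a : a \in s -> seq_min s <= a.
Proof. by move=> sa; exact: (ge_bigmin_seq _ a xpredT id). Qed.

(** Membership is an invariant of the iteration: it starts at the head, and the maximum of two
    entries is one of them. [big_seq] records that each term is an entry. *)
Lemma seq_max_mem s : s != [::] -> seq_max s \in s.
Proof.
case: s => // a s _; rewrite /seq_max big_seq.
by elim/big_ind: _ => [|x y xs ys|//]; [exact: mem_head | case: leP].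
Qed.

Lemma seq_min_mem s : s != [::] -> seq_min s \in s.
Proof.
case: s => // a s _; rewrite /seq_min big_seq.
by elim/big_ind: _ => [|x y xs ys|//]; [exact: mem_head | case: leP].
Qed.

Lemma le_seq_max_map (W : finType) (F : W -> R) (w : W) :
  F w <= seq_max [seq F w | w <- enum W].
Proof. by apply: le_seq_max; apply: map_f; rewrite mem_enum. Qed.

Lemma seq_max_map_arg (W : finType) (F : W -> R) :
  (0 < #|W|)%N -> exists w, seq_max [seq F w | w <- enum W] = F w.
Proof.
rewrite cardE => W_gt0.
have /mapP[w _ ->] :
    seq_max [seq F w | w <- enum W] \in [seq F w | w <- enum W].
  by apply: seq_max_mem; rewrite -size_eq0 size_map -lt0n.
by exists w.
Qed.

End SeqExtrema.

(** The left side is the diagonal of the expanded product, whose other terms are nonnegative. *)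
Lemma ler_sumM (R : realType) (X : finType) (a b : X -> R) :
  (forall x, 0 <= a x) -> (forall x, 0 <= b x) ->
  \sum_x a x * b x <= (\sum_x a x) * (\sum_x b x).
Proof.
move=> a_ge0 b_ge0; rewrite mulr_suml; apply: ler_sum => x _.
apply: ler_wpM2l => //; rewrite (bigD1 x) //= lerDl.
exact: sumr_ge0.
Qed.

Section Leakage.
Variables (R : realType) (X W : finType) (W_gt0 : (0 < #|W|)%N).
Variables (g : W -> X -> R) (g_ge0 : forall w x, 0 <= g w x).
Variable pi : prior R X.

(** A guess [w] optimal for the prior may be made after every output [y]; as the rows of [C] sum to
    1, it still earns [Vg g pi]. *)
Lemma Vg_le_Vg_chan (Y : finType) (C : channel R X Y) :
  Vg g pi <= Vg_chan g pi C.
Proof.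
have [w Vw] := seq_max_map_arg (fun w => \sum_x pi x * g w x) W_gt0.
rewrite /Vg Vw.
apply: (@le_trans _ _ (\sum_y \sum_x pi x * C x y * g w x)); last first.
  apply: ler_sum => y _.
  exact: (le_seq_max_map (fun w => \sum_x pi x * C x y * g w x)).
rewrite exchange_big /=; apply: ler_sum => x _.
by rewrite -mulr_suml -mulr_sumr channel_sum1 mulr1.
Qed.

Definition gain_support : seq R :=
  [seq a <- [seq pi x * g w x | x <- enum X, w <- enum W] | a != 0].

Lemma gain_supportP w x : pi x * g w x != 0 -> pi x * g w x \in gain_support.
Proof.
move=> u_neq0; rewrite mem_filter u_neq0 /=.
by apply/allpairsP; exists (x, w); rewrite !mem_enum.
Qed.

(** If all [pi x * g w x] vanished, [Vg g pi] would be 0. So the list is nonempty and its minimum is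
    an entry, which is nonzero by the filter and nonnegative. *)
Lemma seq_min_gain_support_gt0 : 0 < Vg g pi -> 0 < seq_min gain_support.
Proof.
move=> V_gt0.
have : seq_min gain_support \in gain_support.
  apply: seq_min_mem; apply/eqP => supp0; move: V_gt0; rewrite /Vg.
  have [w ->] := seq_max_map_arg (fun w => \sum_x pi x * g w x) W_gt0.
  rewrite big1 ?ltxx // => x _; apply/eqP/negPn/negP => /gain_supportP.
  by rewrite supp0.
rewrite mem_filter => /andP[neq0 /allpairsP[[x w] [_ _ e]]].
by rewrite lt0r neq0 e mulr_ge0 // prior_ge0.
Qed.

Lemma gain_mul_min_le_sqr w x :
  pi x * g w x * seq_min gain_support <= (pi x * g w x) * (pi x * g w x).
Proof.
(* A zero value escapes the minimum, but then both sides are 0. *)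
have [->|u_neq0] := eqVneq (pi x * g w x) 0; first by rewrite !mul0r.
apply: ler_wpM2l; first by rewrite mulr_ge0 // prior_ge0.
exact/seq_min_le/gain_supportP.
Qed.

Lemma Vg_par_channel_le (Y1 Y2 : finType)
    (C1 : channel R X Y1) (C2 : channel R X Y2) :
  Vg_chan g pi (par_channel C1 C2) * seq_min gain_support <=
  Vg_chan g pi C1 * Vg_chan g pi C2.
Proof.
pose F (Y : finType) (C : channel R X Y) y w := \sum_x pi x * C x y * g w x.
have F_ge0 (Y : finType) (C : channel R X Y) y w : 0 <= F _ C y w.
  by apply: sumr_ge0 => x _; rewrite !mulr_ge0 // ?prior_ge0 ?channel_ge0.
rewrite /Vg_chan !mulr_suml.
under [leRHS]eq_bigr => y1 _ do rewrite mulr_sumr.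
rewrite pair_bigA /=; apply: ler_sum => -[y1 y2] _ /=.
(* The guess optimal for the pair [(y1, y2)] serves as a candidate for [y1] and for [y2]
   separately. *)
have [w ->] := seq_max_map_arg (F _ (par_channel C1 C2) (y1, y2)) W_gt0.
apply: (@le_trans _ _ (F _ C1 y1 w * F _ C2 y2 w)); last first.
  by apply: ler_pM => //; apply: (le_seq_max_map (F _ _ _)).
apply: (le_trans _ (ler_sumM _ _)) => [|x|x]; last 2 first.
- by rewrite !mulr_ge0 // ?prior_ge0 ?channel_ge0.
- by rewrite !mulr_ge0 // ?prior_ge0 ?channel_ge0.
rewrite mulr_suml; apply: ler_sum => x _ /=; rewrite /par_fun /=.
have C12_ge0 : 0 <= C1 x y1 * C2 x y2 by rewrite mulr_ge0 ?channel_ge0.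
have := ler_wpM2l C12_ge0 (gain_mul_min_le_sqr w x).
by congr (_ <= _); lra.
Qed.

End Leakage.

Lemma log2M (R : realType) (a b : R) :
  0 < a -> 0 < b -> log2 (a * b) = log2 a + log2 b.
Proof. by move=> a_gt0 b_gt0; rewrite /log2 lnM ?posrE // mulrDl. Qed.

Lemma ler_log2 (R : realType) (a b : R) :
  0 < a -> a <= b -> log2 a <= log2 b.
Proof.
move=> a_gt0 le_ab; apply: ler_wpM2r; last first.
  by rewrite ler_ln ?posrE // (lt_le_trans a_gt0).
by rewrite invr_ge0 ln_ge0 // ler1n.
Qed.

Unset Implicit Arguments.

Theorem theorem3p13 (R : realType) (X Y1 Y2 W : finType)
    (X_gt0 : (0 < #|X|)%N) (Y1_gt0 : (0 < #|Y1|)%N)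
    (Y2_gt0 : (0 < #|Y2|)%N) (W_gt0 : (0 < #|W|)%N)
    (g : W -> X -> R) (g_01 : forall w x, 0 <= g w x <= 1)
    (pi : prior R X) (Vg_gt0 : 0 < Vg g pi)
    (C1 : channel R X Y1) (C2 : channel R X Y2) :
  Ig g pi (par_channel C1 C2) <=
    Ig g pi C1 + Ig g pi C2 + Hg_min g pi - Hg g pi.
Proof.
have g_ge0 w x : 0 <= g w x by have /andP[] := g_01 w x.
have V_gt0 (Y : finType) (C : channel R X Y) : 0 < Vg_chan g pi C.
  exact: lt_le_trans Vg_gt0 (Vg_le_Vg_chan W_gt0 _ _ _).
have m_gt0 := seq_min_gain_support_gt0 W_gt0 g_ge0 Vg_gt0.
have := ler_log2 (mulr_gt0 (V_gt0 _ _) m_gt0)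
  (Vg_par_channel_le W_gt0 g_ge0 pi C1 C2).
(* Once [Ig] is unfolded, [Hg g pi] occurs with net coefficient 1 on both sides and cancels; what
   remains is the logarithm of [Vg_par_channel_le]. *)
rewrite !log2M // /Ig /Hg_chan /Hg /Hg_min -/(gain_support g pi).
lra.
Qed.
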